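(* Let $\mathsf J\subseteq\mathsf I$ be special subalgebras of a cubic algebra $\mathcal L$. Define $\mathsf J\supset\mathsf I=\bigcap\{\mathsf H: \mathsf H\text{ a special subalgebra with }\mathsf H\vee\mathsf J\text{ defined and }\mathsf H\vee\mathsf J=\mathsf I\}$ and $\mathsf J\to\mathsf I=\{h\in\mathsf I: h\vee g=\mathbf 1\text{ for all }g\in\mathsf J\}$. Then $\mathsf J\supset\mathsf I=\mathsf J\to\mathsf I$.
   Context: A cubic algebra is a join-semilattice $\mathcal L$ with top $\mathbf 1$ and a binary operation $\Delta$ such that: if $x\le y$ then $\Delta(y,x)\vee x=y$; if $x\le y\le z$ then $\Delta(z,\Delta(y,x))=\Delta(\Delta(z,y),\Delta(z,x))$; if $x\le y$ then $\Delta(y,\Delta(y,x))=x$; if $x\le y\le z$ then $\Delta(z,x)\le\Delta(z,y)$; and with $xy:=\Delta(\mathbf 1,\Delta(x\vee y,y))\vee y$ one has $(xy)y=x\vee y$ and $x(yz)=y(xz)$. With $xy$, $\mathcal L$ is an implication algebra; an implication subalgebra is a subset closed under it. A subset $A\subseteq\mathcal L$ is compatible iff for every embedding $e$ of $\mathcal L$ into an interval algebra of a Boolean algebra, $e[A]$ has the finite intersection property; equivalently, $x\vee\Delta(\mathbf 1,y)=\mathbf 1$ for all $x,y\in A$. A special subalgebra is an upwards-closed, compatible implication subalgebra $I$ such that $x\wedge y\in I$ whenever $x,y\in I$ and $x\wedge y$ exists in $\mathcal L$. Intersections of special subalgebras are special. For special subalgebras $\mathsf H,\mathsf J$, $\mathsf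 H\vee\mathsf J$ is defined iff $\mathsf H\cup\mathsf J$ is compatible, and then it is the smallest special subalgebra containing $\mathsf H\cup\mathsf J$. *)

(* Defs.v *)
From HB Require Import structures.
From mathcomp Require Import all_boot all_order.
From mathcomp Require Import boolp classical_sets.

Set Implicit Arguments.
Unset Strict Implicit.
Unset Printing Implicit Defensive.

Import Order.Theory.
Local Open Scope order_scope.

(* The product xy attached to an operation D. *)
Definition imp_of {d : Order.disp_t} {T : tJoinSemilatticeType d}
  (D : T -> T -> T) (x y : T) : T := D \top (D (x `|` y) y) `|` y.

HB.mixin Record isCubicAlgebra (d : Order.disp_t) T
    of Order.TJoinSemilattice d T := {
  Delta : T -> T -> T;
  Delta_join : forall x y : T, x <= y -> Delta y x `|` x = y;
  Delta_Delta : forall x y z : T, x <= y -> y <= z ->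
    Delta z (Delta y x) = Delta (Delta z y) (Delta z x);
  Delta_involutive : forall x y : T, x <= y -> Delta y (Delta y x) = x;
  Delta_monotone : forall x y z : T, x <= y -> y <= z ->
    Delta z x <= Delta z y;
  imp_join : forall x y : T, imp_of Delta (imp_of Delta x y) y = x `|` y;
  imp_exchange : forall x y z : T,
    imp_of Delta x (imp_of Delta y z) = imp_of Delta y (imp_of Delta x z)
}.

#[short(type="cubicAlgebraType")]
HB.structure Definition CubicAlgebra (d : Order.disp_t) :=
  { T of Order.TJoinSemilattice d T & isCubicAlgebra d T }.

Definition imp {d : Order.disp_t} {L : cubicAlgebraType d} (x y : L) : L :=
  imp_of Delta x y.

Section IntervalAlgebra.
Context {d : Order.disp_t} {B : ctbDistrLatticeType d}.

(* A nonempty closed interval [lo, hi] of B. The order is inclusion, so the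
   join is [ijoin] and the top is [itop]. *)
Record closed_interval : Type := ClosedInterval {
  lo : B;
  hi : B;
  lo_le_hi : lo <= hi
}.

Definition points (i : closed_interval) : set B :=
  [set b | lo i <= b <= hi i]%classic.

Definition itop : closed_interval := ClosedInterval (le0x (\top : B)).

Lemma ijoin_proof (i j : closed_interval) : lo i `&` lo j <= hi i `|` hi j.
Proof. exact: le_trans (leIl _ _) (le_trans (lo_le_hi i) (leUl _ _)). Qed.

Definition ijoin (i j : closed_interval) : closed_interval :=
  ClosedInterval (ijoin_proof i j).

Lemma iDelta_proof (i j : closed_interval) :
  lo i `|` (hi i `&` ~` hi j) <= hi i `&` (lo i `|` ~` lo j).
Proof.
rewrite leUx !lexI lo_le_hi leUl leIl /=.
apply: le_trans (leIr _ _) (le_trans _ (leUr _ _)).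
by rewrite leC; exact: lo_le_hi.
Qed.

(* For j included in i, this is the reflection of j through the centre of i. *)
Definition iDelta (i j : closed_interval) : closed_interval :=
  ClosedInterval (iDelta_proof i j).

End IntervalAlgebra.

Arguments closed_interval {d} B.

(* In a cubic algebra, [Delta y x] is only constrained when x <= y, so an
   embedding is required to preserve it only there. *)
Record is_embedding {d d' : Order.disp_t} {L : cubicAlgebraType d}
    {B : ctbDistrLatticeType d'} (e : L -> closed_interval B) : Prop := {
  embedding_injective : injective e;
  embedding_top : e \top = itop;
  embedding_join : forall x y : L, e (x `|` y) = ijoin (e x) (e y);
  embedding_Delta : forall x y : L,
    x <= y -> e (Delta y x) = iDelta (e y) (e x)
}.

Local Close Scope order_scope.
Local Open Scope classical_set_scope.

Section SpecialSubalgebras.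
Context {d : Order.disp_t} {L : cubicAlgebraType d}.
Implicit Types A H J I : set L.

(* e[A] has the finite intersection property, for every embedding e of L into
   the interval algebra of a Boolean algebra. *)
Definition compatible A : Prop :=
  forall (d' : Order.disp_t) (B : ctbDistrLatticeType d')
    (e : L -> closed_interval B), is_embedding e ->
  forall s : seq L, (forall x, x \in s -> A x) ->
  exists b : B, forall x, x \in s -> points (e x) b.

(* As usual for subalgebras of algebras with a definable constant (here
   xx = 1), the empty set is excluded. *)
Definition implication_subalgebra A : Prop :=
  A !=set0 /\ (forall x y, A x -> A y -> A (imp x y)).

Definition upward_closed A : Prop := forall x y, A x -> (x <= y)%O -> A y.

Definition is_meet (x y z : L) : Prop :=
  [/\ (z <= x)%O, (z <= y)%O
    & forall w, (w <= x)%O -> (w <= y)%O -> (w <= z)%O].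

Definition special A : Prop :=
  [/\ implication_subalgebra A, upward_closed A, compatible A
    & forall x y z, A x -> A y -> is_meet x y z -> A z].

Definition vee_defined H J : Prop := compatible (H `|` J).

(* The smallest special subalgebra containing H and J; meaningful only under
   [vee_defined H J]. *)
Definition vee H J : set L := smallest special (H `|` J).

(* J ⊃ I *)
Definition special_supset J I : set L :=
  \bigcap_(H in [set H | [/\ special H, vee_defined H J & vee H J = I]]) H.

(* J -> I *)
Definition special_arrow J I : set L :=
  [set h | I h /\ forall g, J g -> (h `|` g)%O = \top%O].

End SpecialSubalgebras.

(* Main.v *)
Require Import Defs.
From mathcomp Require Import all_boot all_order.
From mathcomp Require Import classical_sets.

(* Write [ab] for [imp a b]. The axioms make L an implication algebra, in which
   existing meets distribute over joins.
   If g is in J, then H = {h in I : h v g = 1} is special, and H v J = I since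
   every i in I is the meet of i v g in J and gi in H. So J ⊃ I lies in every
   such H, hence in J -> I.
   Conversely let k be in J -> I and H v J = I. Then {x in I : k v x in H} is
   special and contains H and J, so it is all of I, and k = k v k is in H. *)

Set Implicit Arguments.
Unset Strict Implicit.
Unset Printing Implicit Defensive.

Import Order.Theory.

Local Open Scope order_scope.

Section ImplicationAlgebra.
Context {d : Order.disp_t} {L : cubicAlgebraType d}.
Implicit Types k x y z : L.

Lemma Delta_le x y : x <= y -> Delta y x <= y.
Proof. by move=> xy; rewrite -[leRHS](Delta_join _ _ xy) leUl. Qed.

(** Monotonicity on [Delta x x <= x <= x], followed by involutivity, gives the inequality missing
    from [Delta_le]. *)
Lemma Delta_diag x : Delta x x = x.
Proof.
have Dx := Delta_le (lexx x).
apply/le_anti; rewrite Dx /=.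
by have := Delta_monotone _ _ _ Dx (lexx x); rewrite Delta_involutive.
Qed.

Lemma le_imp x y : y <= imp x y.
Proof. exact: leUr. Qed.

(** If xy = 1, then x v y = (xy)y = 1y, which involutivity reduces to y. If x <= y, then xy reduces
    to [Delta \top y] v y = 1. *)
Lemma imp_eq1 x y : (imp x y == \top) = (x <= y).
Proof.
apply/eqP/idP => [xy|xy].
  have := imp_join x y; rewrite -![imp_of Delta _ _]/(imp _ _) xy => yE.
  rewrite leEjoin -yE /imp /imp_of join1x Delta_involutive ?lex1 //.
  by rewrite joinxx.
by rewrite /imp /imp_of (join_r xy) Delta_diag Delta_join ?lex1.
Qed.

Lemma impK x y : imp (imp x y) y = x `|` y.
Proof. exact: imp_join. Qed.

Lemma impC x y z : imp x (imp y z) = imp y (imp x z).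
Proof. exact: imp_exchange. Qed.

(** Both sides say x(yz) = y(xz) = 1, so [imp _ z] forms an antitone Galois connection with
    itself. *)
Lemma le_impC x y z : (x <= imp y z) = (y <= imp x z).
Proof. by rewrite -!imp_eq1 impC. Qed.

Lemma le_impl x y z : x <= y -> imp y z <= imp x z.
Proof. by move=> xy; rewrite le_impC impK (le_trans xy) ?leUl. Qed.

Lemma le_impr x y z : y <= z -> imp x y <= imp x z.
Proof.
(* Since z = (zy)y, exchange gives xz = (zy)(xy), which lies above xy. *)
move=> yz; rewrite -[in leRHS](join_l yz) -impK impC.
exact: le_imp.
Qed.

(* With q = x v xy we have qy <= q, so q lies above both r = Delta q y and
   Delta 1 r, whose join is 1. *)
Lemma join_imp x y : x `|` imp x y = \top.
Proof.
set q := x `|` imp x y.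
have yq : y <= q by rewrite (le_trans (le_imp x y)) ?leUr.
have qy : imp q y <= q by rewrite (le_trans (le_impl y (leUl _ _))) ?leUr.
apply/le_anti; rewrite lex1 /= -(Delta_join _ _ (lex1 (Delta q y))) leUx.
rewrite (Delta_le yq) andbT (le_trans _ qy) //.
by rewrite /imp /imp_of (join_l yq) leUl.
Qed.

(** Contraction: if x <= xy, then xy = x v xy = 1. It lets the meet proofs below bound w by bounding
    it by w times the target. *)
Lemma le_imp_self x y : (x <= imp x y) = (x <= y).
Proof.
apply/idP/idP => [xy|xy]; last exact: le_trans xy (le_imp _ _).
by rewrite -imp_eq1 -(join_imp x y) (join_r xy).
Qed.

Lemma is_meet_join_imp x y : is_meet (y `|` x) (imp x y) y.
Proof.
split=> [||w wyx]; [exact: leUl | exact: le_imp |].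
rewrite le_impC => xw; rewrite -le_imp_self (le_trans wyx) //.
by rewrite leUx le_imp.
Qed.

(** Put t = x(yz) = y(xz). Then tz lies below (xz)z = x and (yz)z = y, hence below z, so t = t v z =
    (tz)z = 1. *)
Lemma is_meet_le_imp x y z : is_meet x y z -> x <= imp y z.
Proof.
move=> [zx zy zmax]; set t := imp x (imp y z).
have zt : z <= t by rewrite (le_trans (le_imp y z)) ?le_imp.
have tx : imp t z <= x.
  rewrite -[leRHS](join_l zx) -impK; apply: le_impl.
  by rewrite /t impC le_imp.
have ty : imp t z <= y.
  by rewrite -[leRHS](join_l zy) -impK; apply/le_impl/le_imp.
rewrite -imp_eq1 -/t -(join_l zt) -impK imp_eq1.
exact: zmax.
Qed.

Lemma is_meet_joinl k x y z :
  is_meet x y z -> is_meet (k `|` x) (k `|` y) (k `|` z).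
Proof.
move=> m; have [zx zy _] := m; split; rewrite ?leU2 // => w wx wy.
(* Exchange turns this into y <= w(k v z); as k is below it too, so is k v y, hence w, and
   contraction applies. *)
have wyz : w <= imp y (k `|` z).
  rewrite (le_trans wx) // leUx (le_trans (leUl _ z)) ?le_imp //=.
  by rewrite (le_trans (is_meet_le_imp m)) // le_impr ?leUr.
rewrite -le_imp_self (le_trans wy) // leUx (le_impC y) wyz andbT.
by rewrite (le_trans (leUl _ z)) ?le_imp.
Qed.

Lemma is_meet_top z : is_meet (\top : L) \top z -> z = \top.
Proof.
case=> _ _ /(_ \top); rewrite !lexx => /(_ isT isT).
by rewrite le1x => /eqP.
Qed.

End ImplicationAlgebra.

Local Close Scope order_scope.
Local Open Scope classical_set_scope.

Section Special.
Context {d : Order.disp_t} {L : cubicAlgebraType d}.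
Implicit Types A B H I J : set L.

Lemma sub_compatible A B : A `<=` B -> compatible B -> compatible A.
Proof. by move=> AB cB d' C e he s sA; apply: (cB _ C e he) => x /sA/AB. Qed.

Lemma special_top A : special A -> A \top%O.
Proof. by move=> [[[x Ax] _] up _ _]; apply: up Ax (lex1 x). Qed.

(** Closure under products comes from upward closure, closure under meets from distributivity. The
    theorem uses it with H = {1} and with an arbitrary competitor H. *)
Lemma special_join_preimage I H (k : L) : special I -> special H ->
  special [set x | I x /\ H (k `|` x)%O].
Proof.
move=> hI hH; have [_ upI cI mI] := hI; have [_ upH _ mH] := hH.
have up : upward_closed [set x | I x /\ H (k `|` x)%O].
  move=> x y [Ix Hx] xy; split; first exact: upI Ix xy.
  by apply: upH Hx _; rewrite leU2.
split=> //.
- split; first by exists \top%O; rewrite /= joinx1; split; exact: special_top.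
  by move=> x y _ Sy; apply: up Sy (le_imp x y).
- by apply: sub_compatible cI => x [].
move=> x y z [Ix Hx] [Iy Hy] m; split; first exact: mI Ix Iy m.
exact: mH Hx Hy (is_meet_joinl k m).
Qed.

Lemma special_set1_top I : special I -> special [set (\top : L)%O].
Proof.
move=> hI; have [_ _ cI _] := hI; split.
- split; first by exists \top%O.
  by move=> x y /= -> ->; apply/eqP; rewrite imp_eq1.
- by move=> x y /= ->; rewrite le1x => /eqP.
- by apply: sub_compatible cI => x /= ->; exact: special_top.
- by move=> x y z /= -> ->; exact: is_meet_top.
Qed.

Lemma vee_relative_complement I J (g : L) : special I -> special J ->
  J `<=` I -> J g ->
  vee [set x | I x /\ (g `|` x)%O = \top%O] J = I.
Proof.
move=> hI [_ upJ _ _] JI Jg; have [_ upI _ _] := hI.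
apply/seteqP; split.
  by apply: smallest_sub => // x [[]|/JI].
move=> i Ii S [[_ _ _ mS] HJS].
apply: mS (is_meet_join_imp g i); apply: HJS; last left.
  by right; apply: upJ Jg _; rewrite leUr.
by split; [exact: upI Ii (le_imp _ _) | exact: join_imp].
Qed.

End Special.

Theorem theorem7p22 (d : Order.disp_t) (L : cubicAlgebraType d)
    (J I : set L) (hJ : special J) (hI : special I) (hJI : J `<=` I) :
  special_supset J I = special_arrow J I.
Proof.
have [_ _ cI _] := hI.
apply/seteqP; split=> [x xJI|k [Ik kJ] H [hH _ HJI]].
  have xg g : J g -> I x /\ (g `|` x)%O = \top%O.
    move=> Jg; apply: (xJI [set x | I x /\ (g `|` x)%O = \top%O]); split.
    - exact: special_join_preimage hI (special_set1_top hI).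
    - by apply: sub_compatible cI => y [[]|/hJI].
    - exact: vee_relative_complement.
  (* Membership in I needs some g in J; 1 serves. *)
  split=> [|g Jg]; first by case: (xg _ (special_top hJ)).
  by rewrite joinC; case: (xg _ Jg).
have [_ upH _ _] := hH.
have IS : I `<=` [set x | I x /\ H (k `|` x)%O].
  rewrite -[X in X `<=` _]HJI.
  apply: smallest_sub; first exact: special_join_preimage.
  move=> x HJx; split; first by rewrite -HJI; apply: sub_smallest HJx.
  case: HJx => [Hx|Jx]; first by apply: upH Hx _; rewrite leUr.
  by rewrite kJ //; exact: special_top.
by have [_] := IS k Ik; rewrite joinxx.
Qed.
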